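(* Let $k$ be an algebraically closed field of characteristic $p>0$, $X$ an affine $k$-variety with ring of regular functions $A=k[X]$, and $G$ a finite group acting on $X$ (by automorphisms of the variety, hence on $A$ by $k$-algebra automorphisms). Then the following are equivalent: (1) $A\in\mathfrak{Ts}_G$, i.e. the trace map $\mathrm{tr}_G: A\to A^G$ is surjective; (2) for every $x\in X$ the point stabilizer $G_x$ has order coprime to $p$; (3) for one (and then for every) Sylow $p$-subgroup $P\le G$, the ring extension $A^P\le A$ is a Galois extension with group $P$.
   Context: For a finite group $G$ acting on a commutative $k$-algebra $A$ by $k$-algebra automorphisms, $A^G$ is the ring of invariants and $\mathrm{tr}_G: A\to A^G$, $a\mapsto\sum_{g\in G} ag$. $\mathfrak{Ts}_G$ is the category of finitely generated commutative $k$-algebras $A$ with $G$-action by $k$-algebra automorphisms such that $\mathrm{tr}_G(A)=A^G$ (with $G$-equivariant $k$-algebra homomorphisms). For a finite group $P$ acting on a commutative ring $A$ by ring automorphisms, $A^P\le A$ is called a Galois extension with group $P$ (in the sense of Auslander-Goldman and Chase-Harrison-Rosenberg) if there are elements $x_1,\dots,x_n,y_1,\dots,y_n\in A$ such that for all $g\in P$: $\sum_{i=1}^n x_i\,(y_i)g=1$ if $g=1$ and $=0$ if $g\ne1$. (Equivalently: $A$ is a finitely generated projective $A^P$-module and the natural ring homomorphism from the crossed product of $P$ and $A$ to $\mathrm{End}_{A^P}(A)$ is an isomorphism.) *)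

(* Defs.v *)
From HB Require Import structures.
From mathcomp Require Import all_boot all_algebra all_fingroup all_solvable.
From mathcomp Require Import boolp classical_sets functions.
From mathcomp.multinomials Require Import mpoly.

Set Implicit Arguments.
Unset Strict Implicit.
Unset Printing Implicit Defensive.

Import GRing.Theory.
Local Open Scope ring_scope.

(* A commutative k-algebra is a commutative ring A with a structure morphism  *)
(* [iota : {rmorphism k -> A}]. The library's [comAlgType] excludes the zero  *)
(* ring, which is the coordinate ring of the empty variety.                   *)

(* The condition says that evaluation k[T_1, ..., T_n] -> A at the generators *)
(* is onto; [mmap] itself is only available for nonzero rings.                *)
Definition finitely_generated (k : comNzRingType) (A : comPzRingType)
    (iota : {rmorphism k -> A}) : Prop :=
  exists (n : nat) (a : 'I_n -> A), forall b : A, exists q : {mpoly k[n]},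
    b = \sum_(m <- msupp q) iota q@_m * \prod_(i < n) a i ^+ m i.

(* The library states [actM] and [act1] for actions on finite types only.     *)
Lemma total_actM (gT : finGroupType) (T : Type) (to : {action gT &-> T}) (x : T) :
  act_morph to x.
Proof.
have [_ toM] : is_action [set: gT] to by case: to.
by move=> g h; rewrite toM ?finset.in_setT.
Qed.

Lemma total_act1 (gT : finGroupType) (T : Type) (to : {action gT &-> T}) (x : T) :
  to x 1%g = x.
Proof.
have [to_inj _] : is_action [set: gT] to by case: to.
by apply: (to_inj 1%g); rewrite -total_actM mulg1.
Qed.

(* Actions of the finite group gT are right actions, as in MathComp. Each     *)
(* [ract^~ g] is bijective with inverse [ract^~ g^-1].                        *)
Record ring_action (gT : finGroupType) (A : comPzRingType) := RingAction {
  ract :> {action gT &-> A};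
  ract_additive : forall g : gT, {morph ract^~ g : a b / a + b};
  ract_multiplicative : forall g : gT, monoid_morphism (ract^~ g)
}.

Record alg_action (k : comNzRingType) (gT : finGroupType) (A : comPzRingType)
    (iota : {rmorphism k -> A}) := AlgAction {
  alg_ract :> ring_action gT A;
  alg_ract_scalar : forall (g : gT) (c : k), alg_ract (iota c) g = iota c
}.

Section RingActions.
Variables (gT : finGroupType) (A : comPzRingType) (to : ring_action gT A).

Definition ring_invariants : set A :=
  [set a | forall g : gT, to a g = a]%classic.

Definition ring_trace (a : A) : A := \sum_(g : gT) to a g.

Definition galois_extension (P : {group gT}) : Prop :=
  exists (n : nat) (x y : 'I_n -> A), forall g : gT, g \in P ->
    \sum_(i < n) x i * to (y i) g = if g == 1%g then 1 else 0.

End RingActions.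

Definition in_Ts (k : comNzRingType) (gT : finGroupType) (A : comPzRingType)
    (iota : {rmorphism k -> A}) (to : alg_action gT iota) : Prop :=
  finitely_generated iota /\ range (ring_trace to) = ring_invariants to.

Definition zero_locus (k : fieldType) (n : nat) (S : set {mpoly k[n]}) :
    set 'rV[k]_n :=
  [set x : 'rV[k]_n | forall q, S q -> q.@[x ord0] = 0]%classic.

(* Varieties need not be irreducible. *)
Record affine_variety (k : fieldType) := AffineVariety {
  av_dim : nat;
  av_set : set 'rV[k]_av_dim;
  av_closed : exists S : set {mpoly k[av_dim]}, av_set = zero_locus S
}.

Arguments av_set {k} _.

Definition av_point (k : fieldType) (X : affine_variety k) : Type :=
  {x : 'rV[k]_(av_dim X) | x \in av_set X}.
Coercion av_point : affine_variety >-> Sortclass.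
HB.instance Definition _ (k : fieldType) (X : affine_variety k) :=
  Choice.on (av_point X).

Definition regular (k : fieldType) (X : affine_variety k) (f : X -> k) : Prop :=
  exists q : {mpoly k[av_dim X]}, forall x : X, f x = q.@[val x ord0].

Definition variety_morphism (k : fieldType) (X Y : affine_variety k)
    (phi : X -> Y) : Prop :=
  forall j : 'I_(av_dim Y), regular (fun x : X => val (phi x) ord0 j).

(* Each [vact^~ g] is an automorphism, with inverse [vact^~ g^-1]. *)
Record variety_action (k : fieldType) (gT : finGroupType)
    (X : affine_variety k) := VarietyAction {
  vact :> {action gT &-> X};
  vact_morphism : forall g : gT, variety_morphism (vact^~ g)
}.

Definition point_stabilizer (k : fieldType) (gT : finGroupType)
    (X : affine_variety k) (to : variety_action gT X) (x : X) : {set gT} :=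
  [set g | to x g == x]%SET.

Section CoordinateRing.
Variables (k : fieldType) (X : affine_variety k).

Definition regular_pred : {pred X -> k} := fun f => `[< regular f >].

Lemma regularP f : reflect (regular f) (f \in regular_pred).
Proof. exact: asboolP. Qed.

Record coord_ring := CoordRing {
  coord_fun :> X -> k;
  coord_fun_regular : coord_fun \in regular_pred
}.

HB.instance Definition _ := [isSub for coord_fun].
HB.instance Definition _ := [Choice of coord_ring by <:].

Lemma regular_subring_closed : subring_closed regular_pred.
Proof.
split.
- by apply/regularP; exists 1 => x; rewrite rmorph1.
- move=> f g /regularP[q fE] /regularP[r gE]; apply/regularP.
  by exists (q - r) => x; rewrite rmorphB /= -fE -gE.
- move=> f g /regularP[q fE] /regularP[r gE]; apply/regularP.
  by exists (q * r) => x; rewrite rmorphM /= -fE -gE.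
Qed.

HB.instance Definition _ :=
  GRing.SubChoice_isSubComPzRing.Build (X -> k) regular_pred coord_ring
    regular_subring_closed.

Lemma regular_const (c : k) : (fun=> c) \in regular_pred.
Proof. by apply/regularP; exists c%:MP => x; rewrite mevalC. Qed.

Definition coord_const (c : k) : coord_ring := CoordRing (regular_const c).

Lemma coord_const_additive : zmod_morphism coord_const.
Proof. by move=> a b; apply/val_inj/funext. Qed.

Lemma coord_const_multiplicative : monoid_morphism coord_const.
Proof. by split=> [|a b]; apply/val_inj/funext. Qed.

HB.instance Definition _ :=
  GRing.isZmodMorphism.Build k coord_ring coord_const coord_const_additive.
HB.instance Definition _ := GRing.isMonoidMorphism.Build k coord_ring
  coord_const coord_const_multiplicative.

End CoordinateRing.

Lemma regular_comp (k : fieldType) (X Y : affine_variety k) (phi : X -> Y)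
    (f : Y -> k) :
  variety_morphism phi -> regular f -> regular (f \o phi).
Proof.
move=> /choice[h phiE] [q fE].
exists (q \mPo [tuple h j | j < av_dim Y]) => x.
rewrite /= fE comp_mpoly_meval; apply: meval_eq => j.
by rewrite tnth_map tnth_ord_tuple phiE.
Qed.

Section CoordinateAction.
Variables (k : fieldType) (gT : finGroupType) (X : affine_variety k).
Variable to : variety_action gT X.

Lemma coord_act_regular (f : coord_ring X) (g : gT) :
  (fun x => f (to x g^-1%g)) \in @regular_pred k X.
Proof.
apply/regularP; apply: (regular_comp (vact_morphism to g^-1%g)).
exact/regularP/coord_fun_regular.
Qed.

(* With G acting on the right on X, [(f g)(x) = f (x g^-1)] is a right action *)
(* on k[X].                                                                   *)
Definition coord_act (f : coord_ring X) (g : gT) : coord_ring X :=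
  CoordRing (coord_act_regular f g).

Lemma coord_act1 : coord_act^~ 1%g =1 id.
Proof. by move=> f; apply/val_inj/funext => x /=; rewrite invg1 total_act1. Qed.

Lemma coord_actM f : act_morph coord_act f.
Proof. by move=> g h; apply/val_inj/funext => x /=; rewrite invMg total_actM. Qed.

Lemma coord_act_additive (g : gT) : {morph coord_act^~ g : a b / a + b}.
Proof. by move=> a b; apply/val_inj/funext. Qed.

Lemma coord_act_multiplicative (g : gT) : monoid_morphism (coord_act^~ g).
Proof. by split=> [|a b]; apply/val_inj/funext. Qed.

Definition coord_ring_action : ring_action gT (coord_ring X) :=
  @RingAction _ _ (TotalAction coord_act1 coord_actM)
    coord_act_additive coord_act_multiplicative.

Lemma coord_act_const (g : gT) (c : k) :
  coord_ring_action (coord_const X c) g = coord_const X c.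
Proof. by apply/val_inj/funext. Qed.

Definition coord_alg_action : alg_action gT (@coord_const k X) :=
  AlgAction coord_act_const.

End CoordinateAction.

(* Main.v *)
Require Import Defs.
From HB Require Import structures.
From mathcomp Require Import all_boot all_algebra all_fingroup all_solvable.
From mathcomp Require Import boolp classical_sets functions.
From mathcomp.multinomials Require Import mpoly.

(* (1) => (2): the trace of f at x is a sum over cosets of G_x of multiples of
   #|G_x|, hence zero if p divides #|G_x|.
   (2) => (3): a Sylow p-subgroup P acts freely, so for 1 != g in P the elements
   a - a g have no common zero; by the Nullstellensatz they generate the unit
   ideal, which gives x_i, y_i with \sum x_i y_i = 1 and \sum x_i (y_i g) = 0.
   The products of these families over all g != 1 form a Galois system.
   (3) => (1): x_j = \sum_i x_i tr_P (y_i x_j), so A = tr_P(A) A, and the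
   determinant trick yields a with tr_P a = 1; then tr_G a = #|G : P|, a unit.
   The Nullstellensatz is proved for prime ideals, by adding one variable at a
   time with pseudo-division in place of a coordinate change. *)

Set Implicit Arguments.
Unset Strict Implicit.
Unset Printing Implicit Defensive.

Import GRing.Theory.
Local Open Scope ring_scope.

(** * Ideals and prime ideals of commutative rings *)

Definition ideal (R : comPzRingType) (I : set R) : Prop :=
  [/\ I 0, forall a b, I a -> I b -> I (a + b) & forall a b, I b -> I (a * b)].

Definition prime_ideal (R : comPzRingType) (I : set R) : Prop :=
  [/\ ideal I, ~ I 1 & forall a b, I (a * b) -> I a \/ I b].

Section Ideals.
Variables (R : comPzRingType) (I : set R).
Hypothesis idI : ideal I.

Lemma ideal0 : I 0. Proof. by case: idI. Qed.

Lemma idealD a b : I a -> I b -> I (a + b). Proof. by case: idI => _ + _; apply. Qed.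

Lemma idealMr a b : I b -> I (a * b). Proof. by case: idI => _ _; apply. Qed.

Lemma idealMl a b : I a -> I (a * b). Proof. by rewrite mulrC; apply: idealMr. Qed.

Lemma idealB a b : I a -> I b -> I (a - b).
Proof. by move=> Ia Ib; rewrite -mulN1r; apply: idealD => //; apply: idealMr. Qed.

Lemma ideal_sum (J : Type) (r : seq J) (P : pred J) (F : J -> R) :
  (forall j, P j -> I (F j)) -> I (\sum_(j <- r | P j) F j).
Proof. by move=> IF; apply: big_ind => //; [apply: ideal0 | apply: idealD]. Qed.

End Ideals.

Section Preimage.
Variables (R S : comPzRingType) (f : {rmorphism R -> S}) (I : set S).

Lemma ideal_preim : ideal I -> ideal (f @^-1` I)%classic.
Proof.
move=> idI; split=> [|a b Ia Ib|a b Ib] /=.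
- by rewrite rmorph0; apply: (ideal0 idI).
- by rewrite rmorphD; apply: (idealD idI).
- by rewrite rmorphM; apply: (idealMr idI).
Qed.

Lemma prime_ideal_preim : prime_ideal I -> prime_ideal (f @^-1` I)%classic.
Proof.
move=> [/ideal_preim idI I1 primeM]; split=> //= [|a b].
  by rewrite rmorph1.
by rewrite rmorphM; apply: primeM.
Qed.

End Preimage.

Lemma prime_idealX (R : comPzRingType) (I : set R) a n :
  prime_ideal I -> I (a ^+ n) -> I a.
Proof.
case=> _ I1 prI; elim: n => [/I1 //|n IHn]; rewrite exprS => /prI[] //.
Qed.

(** * Lifting points along the adjunction of one variable *)

Section PolynomialExtension.
Variables (k : closedFieldType) (R : comNzRingType) (I : set {poly R}).
Hypothesis prI : prime_ideal I.

Let idI : ideal I. Proof. by case: prI. Qed.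

Let contraction : set R := [set r | I r%:P]%classic.

Let primeM a b : contraction (a * b) -> contraction a \/ contraction b.
Proof. by rewrite /contraction /= polyCM; case: prI => _ _; apply. Qed.

Let primeX a n : contraction (a ^+ n) -> contraction a.
Proof. by rewrite /contraction /= rmorphXn => /(prime_idealX prI). Qed.

Let id_contraction : ideal contraction.
Proof. exact: (ideal_preim (@polyC R)). Qed.

(** The extension of the contraction back to [{poly R}], that is, the kernel of reducing
    coefficients modulo the contraction. *)
Let extended : set {poly R} := [set g | forall i, contraction g`_i]%classic.

(* f is good if its degree does not drop modulo the contraction of I. *)
Let good (f : {poly R}) : Prop := ~ contraction (lead_coef f).

Let id_extended : ideal extended.
Proof.
split=> [i|a b Ia Ib i|a b Ib i].
- by rewrite coef0; apply: (ideal0 id_contraction).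
- by rewrite coefD; apply: (idealD id_contraction).
- by rewrite coefM; apply: (ideal_sum id_contraction) => // j _; apply: (idealMr id_contraction).
Qed.

Let extended_sub g : extended g -> I g.
Proof.
move=> eg; rewrite -[g]coefK poly_def; apply: (ideal_sum idI) => // i _.
by rewrite -mul_polyC; apply: (idealMl idI) => //; apply: eg.
Qed.

Let not_extended_good f : good f -> ~ extended f.
Proof. by move=> gf ef; apply/gf/ef. Qed.

(** Leading terms whose coefficient lies in the contraction are removed one by one; this stops
    because some coefficient of [g] survives. *)
Let good_truncation g : ~ extended g ->
  exists f, [/\ good f, (size f <= size g)%N & extended (g - f)].
Proof.
have [n] := ubnP (size g); elim: n g => // n IHn g /ltnSE-le_gn neg.
have [gg|/contrapT lg] := pselect (good g).
  by exists g; split=> //; rewrite subrr; apply: (ideal0 id_extended).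
have g0 : g != 0.
  by apply: contra_notN neg => /eqP->; apply: (ideal0 id_extended).
set h := g - (lead_coef g)%:P * 'X^((size g).-1).
have ext_l : extended (g - h).
  rewrite /h subKr mulrC; apply: (idealMr id_extended) => // i.
  by rewrite coefC; case: ifP => // _; apply: (ideal0 id_contraction).
have szh : (size h < size g)%N.
  rewrite -[X in (_ < X)%N]prednK ?size_poly_gt0 // ltnS.
  apply/leq_sizeP => j le_j; rewrite coefB coefCM coefXn.
  have [->|ne_j] := eqVneq j (size g).-1; first by rewrite mulr1 subrr.
  rewrite mulr0 subr0 nth_default //.
  have := ltn_neqAle (size g).-1 j; rewrite le_j eq_sym ne_j.
  by rewrite prednK ?size_poly_gt0.
have [||f [gf sf ef]] := IHn h.
- exact: leq_trans szh le_gn.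
- by move=> eh; apply: neg; rewrite -(subrK h g); apply: (idealD id_extended).
exists f; split=> //; first exact/ltnW/(leq_ltn_trans sf).
by rewrite -(subrK h g) -addrA; apply: (idealD id_extended).
Qed.

(** Take a good [f] in [J] of least size. A smaller [r] in [J] that is not extended would truncate
    to a smaller good element, still in [J] since [extended] lies in [I] and [I] in [J]. *)
Let good_minimal (J : set {poly R}) g : ideal J -> (I `<=` J)%classic ->
    J g -> ~ extended g ->
  exists f, [/\ J f, good f & forall r, J r -> (size r < size f)%N -> extended r].
Proof.
move=> idJ IJ Jg neg.
have trJ r f : J r -> extended (r - f) -> J f.
  by move=> Jr /extended_sub/IJ Jrf; rewrite -[f](subKr r); apply: (idealB idJ).
pose P n := `[< exists f, [/\ J f, good f & size f = n] >].
have exP : exists n, P n.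
  have [f [gf _ ef]] := good_truncation neg.
  by exists (size f); apply/asboolP; exists f; split=> //; apply: trJ ef.
case: (ex_minnP exP) => n /asboolP[f [Jf gf szf]] minf.
exists f; split=> // r Jr lt_r; apply: contrapT => ner.
have [h [gh sh eh]] := good_truncation ner.
have /minf : P (size h) by apply/asboolP; exists h; split=> //; apply: trJ eh.
by rewrite -szf leqNgt (leq_ltn_trans sh).
Qed.

(** Here [phi] is a point of the zero locus of the contraction and [x] its new coordinate.
    Pseudo-division inverts leading coefficients, so only points off the hypersurface [d = 0] are
    lifted. *)
Lemma point_extension (s : {poly R}) : ~ I s ->
  exists2 d : R, ~ I d%:P &
    forall phi : {rmorphism R -> k},
      (forall r, I r%:P -> phi r = 0) -> phi d != 0 ->
    exists x : k, (forall g, I g -> (map_poly phi g).[x] = 0) /\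
      (map_poly phi s).[x] != 0.
Proof.
move=> Is.
have kill_extended (phi : {rmorphism R -> k}) :
    (forall r, I r%:P -> phi r = 0) -> forall g, extended g -> map_poly phi g = 0.
  by move=> phi0 g eg; apply/polyP => i; rewrite coef_map coef0; apply: phi0; apply: eg.
have [Iext|/existsNP[g /not_implyP[Ig neg]]] :=
    pselect (forall g, I g -> extended g).
  (* The fibre over [phi] is the whole line, so it is enough that one coefficient of [s] survives
     under [phi]. *)
  have /existsNP[i Isi] : ~ extended s := fun es => Is (extended_sub es).
  exists s`_i => // phi phi0 phis.
  have /closed_nonrootP[x nrx] : map_poly phi s != 0.
    apply: contra_neq phis => /(congr1 (fun q : {poly k} => q`_i)).
    by rewrite coef_map coef0.
  by exists x; split=> // g Ig; rewrite (kill_extended phi phi0) ?horner0 //; apply: Iext.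
(* Over the fraction field of R modulo the contraction of I, f generates the
   image of I and h is a gcd of f and s, hence a constant. *)
have [f [If gf minf]] := good_minimal idI (fun _ => id) Ig neg.
(* The ideal generated by [I] and [s]. *)
pose J : set {poly R} := [set h | exists u, I (h - u * s)]%classic.
have idJ : ideal J.
  split=> [|a b [u Iu] [v Iv]|a b [u Iu]].
  - by exists 0; rewrite mul0r subr0; apply: (ideal0 idI).
  - by exists (u + v); rewrite mulrDl opprD addrACA; apply: (idealD idI).
  - by exists (a * u); rewrite -mulrA -mulrBr; apply: (idealMr idI).
have IJ : (I `<=` J)%classic by move=> a Ia; exists 0; rewrite mul0r subr0.
have Js : J s by exists 1; rewrite mul1r subrr; apply: (ideal0 idI).
have [h [Jh gh minh]] := good_minimal idJ IJ (IJ _ If) (not_extended_good gf).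
have good_neq0 q : good q -> q != 0.
  by apply: contra_notN => /eqP->; rewrite /contraction /= lead_coef0; apply: (ideal0 idI).
(* If [h] had positive degree, dividing [f] by [h] would leave an extended remainder, so [q * h]
   would lie in the prime ideal [I]; both factors are then excluded. *)
have szh : (size h <= 1)%N.
  rewrite leqNgt; apply/negP => h_gt1.
  have [m q r Ef sr] := Pdiv.ComRing.redivpP f h.
  have {sr} er : extended r.
    apply: minh; last exact/sr/good_neq0.
    have -> : r = (lead_coef h ^+ m)%:P * f - q * h by rewrite mul_polyC Ef addrC addKr.
    by apply: (idealB idJ) => //; apply: (idealMr idJ) => //; apply: IJ.
  have Iqh : I (q * h).
    have -> : q * h = (lead_coef h ^+ m)%:P * f - r by rewrite mul_polyC Ef addrK.
    by apply: (idealB idI) => //; [apply: (idealMr idI) | apply: extended_sub].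
  have [_ _ /(_ _ _ Iqh)[Iq|Ih]] := prI.
    (* If [q] is extended, so is a multiple of [f] by a power of [lead_coef h], against goodness.
       Otherwise its truncation [q'] is at least as long as [f], and [q' * h] has its top
       coefficient, at index [N], beyond the support of [f]. *)
    have [eq|neq] := pselect (extended q).
      have : contraction (lead_coef h ^+ m * lead_coef f).
        by rewrite -coefZ Ef; apply: (idealD id_extended) => //; apply: (idealMl id_extended).
      by case/primeM => // /primeX.
    have [q' [gq' _ eq']] := good_truncation neq.
    have Iq' : I q'.
      by rewrite -[q'](subKr q); apply: (idealB idI) => //; apply: extended_sub.
    have szq' : (size f <= size q')%N.
      by rewrite leqNgt; apply/negP => /(minf _ Iq'); apply: not_extended_good.
    have : contraction (lead_coef q' * lead_coef h).
      rewrite mul_lead_coef; set N := (_).-2.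
      have le_fN : (size f <= N)%N.
        rewrite /N -subn2 leq_subRL; last by rewrite (leq_trans h_gt1) ?leq_addl.
        by rewrite addnC leq_add.
      have -> : q' * h = (lead_coef h ^+ m) *: f - r - (q - q') * h.
        by rewrite Ef addrK mulrBl subKr.
      rewrite !coefB coefZ (nth_default _ le_fN) mulr0 sub0r -opprD -mulN1r.
      apply: (idealMr id_contraction); apply: (idealD id_contraction) => //.
      exact: (idealMl id_extended).
    by case/primeM.
  (* If [h] lies in [I], remainders modulo [f] are shorter than [h]. The one of [s] is thus
     extended, which puts a multiple of [s] by a power of [lead_coef f] in [I]. *)
  have szfh : (size f <= size h)%N.
    by rewrite leqNgt; apply/negP => /(minf _ Ih); apply: not_extended_good.
  have [m' q' r' Es sr'] := Pdiv.ComRing.redivpP s f.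
  have r'E : r' = (lead_coef f ^+ m')%:P * s - q' * f.
    by rewrite mul_polyC Es addrC addKr.
  have er' : extended r'.
    apply: minh; last exact/(leq_trans _ szfh)/sr'/good_neq0.
    by rewrite r'E; apply: (idealB idJ) => //; apply: (idealMr idJ) => //; apply: IJ.
  have : I ((lead_coef f ^+ m')%:P * s).
    rewrite -(subrK (q' * f) (_ * s)) -r'E; apply: (idealD idI) => //.
      exact: extended_sub.
    exact: (idealMr idI).
  by case: prI => _ _ /[apply] -[/primeX|].
have hC : h = (lead_coef h)%:P.
  by rewrite lead_coefE [LHS]size1_polyC //; case: (size h) szh => [|[]].
(* The first factor preserves the degree of [f] under [phi], the second keeps the constant [h]
   nonzero. *)
exists (lead_coef f * lead_coef h) => [/primeM[]//|phi phi0].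
rewrite rmorphM mulf_eq0 negb_or => /andP[phif phih].
have szf : size (map_poly phi f) != 1%N.
  rewrite size_map_poly_id0 //; apply: contra_notN gf => /eqP szf.
  by rewrite /contraction /= lead_coefE szf -size1_polyC ?szf.
have /closed_rootP[x /rootP fx0] := szf.
have Ix g' : I g' -> (map_poly phi g').[x] = 0.
  move=> Ig'; have [m q r Eg sr] := Pdiv.ComRing.redivpP g' f.
  have er : extended r.
    apply: minf; last exact/sr/good_neq0.
    have -> : r = (lead_coef f ^+ m)%:P * g' - q * f by rewrite mul_polyC Eg addrC addKr.
    by apply: (idealB idI) => //; apply: (idealMr idI).
  have := congr1 (fun q => (map_poly phi q).[x]) Eg.
  rewrite /= map_polyZ rmorphD rmorphM /= !hornerE fx0 mulr0 (kill_extended phi phi0 r er).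
  rewrite horner0 addr0 => /eqP; rewrite mulf_eq0 rmorphXn expf_eq0.
  by rewrite (negPf phif) andbF => /eqP.
exists x; split=> //; have [u /Ix] := Jh.
rewrite hC rmorphB rmorphM /= map_polyC /= !hornerE => /eqP; rewrite subr_eq0 => /eqP Eh.
by apply: contraNneq phih => sx0; rewrite Eh sx0 mulr0.
Qed.

End PolynomialExtension.

(** * Prime ideals above proper ideals *)

Lemma prime_ideal_above (R : comPzRingType) (I : set R) :
  ideal I -> ~ I 1 -> exists2 M, prime_ideal M & (I `<=` M)%classic.
Proof.
move=> idI I1.
pose P (X : set R) := X = set0 \/ [/\ ideal X, (I `<=` X)%classic & ~ X 1].
have [F FP totF|M [PM maxM]] := @Zorn_bigcup R P.
  have [F0|/existsNP[X0 /not_implyP[FX0 X0n]]] := pselect (forall X, F X -> X = set0).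
    by left; rewrite -subset0 => x [X /F0 ->].
  have FE X x : F X -> X x -> [/\ ideal X, (I `<=` X)%classic & ~ X 1].
    by move=> /FP[-> //|[]]; split.
  have [idX0 IX0 _] : [/\ ideal X0, (I `<=` X0)%classic & ~ X0 1].
    by case: (FP _ FX0).
  right; split=> [|x Ix|[X FX X1]]; last by have [] := FE _ _ FX X1.
    split=> [|a b [X FX Xa] [Y FY Yb]|a b [X FX Xb]].
    - by exists X0 => //; apply: (ideal0 idX0).
    - have [idX _ _] := FE _ _ FX Xa; have [idY _ _] := FE _ _ FY Yb.
      have [XY|YX] := totF _ _ FX FY.
        by exists Y => //; apply: (idealD idY) => //; apply: XY.
      by exists X => //; apply: (idealD idX) => //; apply: YX.
    - by have [idX _ _] := FE _ _ FX Xb; exists X => //; apply: (idealMr idX).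
  by exists X0 => //; apply: IX0.
have [idM IM M1] : [/\ ideal M, (I `<=` M)%classic & ~ M 1].
  case: PM => // M0; case: (maxM I); last by right; split.
  by rewrite M0 properEneq; split=> //; apply/eqP => I0; have := ideal0 idI; rewrite -I0.
exists M => //; split=> // a b Mab.
have [|Ma] := pselect (M a); [by left | right].
(* The ideal generated by [M] and [a]; by maximality it contains 1, so [a] is invertible modulo
   [M]. *)
pose N : set R := [set x | exists u, M (x - u * a)]%classic.
have MN : (M `<=` N)%classic by move=> x Mx; exists 0; rewrite mul0r subr0.
have Na : N a by exists 1; rewrite mul1r subrr; apply: (ideal0 idM).
have [u Mu] : N 1.
  apply: contrapT => N1; apply: (maxM N).
    by split=> // NM; apply/Ma/NM.
  right; split=> //; last by move=> x /IM/MN.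
  split=> [|x y [v Mv] [w Mw]|x y [v Mv]].
  - by apply/MN/(ideal0 idM).
  - by exists (v + w); rewrite mulrDl opprD addrACA; apply: (idealD idM).
  - by exists (x * v); rewrite -mulrA -mulrBr; apply: (idealMr idM).
rewrite -[b](subrK (u * (a * b))); apply: (idealD idM); last exact: (idealMr idM).
by rewrite mulrA -[X in X - _]mul1r -mulrBl; apply: (idealMl idM).
Qed.

(** * The Nullstellensatz for polynomial rings *)

Lemma mpoly_rmorph_ext (R S : comNzRingType) n (f g : {rmorphism {mpoly R[n]} -> S}) :
  (forall c, f c%:MP = g c%:MP) -> (forall i, f 'X_i = g 'X_i) -> f =1 g.
Proof.
move=> fgC fgX q; rewrite (mpolyE q) !rmorph_sum; apply: eq_bigr => m _.
rewrite -mul_mpolyC mpolyXE_id !rmorphM !rmorph_prod /= fgC; congr (_ * _).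
by apply: eq_bigr => i _; rewrite !rmorphXn fgX.
Qed.

Section LastVariable.
Variables (R : comNzRingType) (n : nat).

Definition poly_to_mpoly (f : {poly {mpoly R[n]}}) : {mpoly R[n.+1]} :=
  (map_poly (@mwiden n R) f).['X_ord_max].

Lemma poly_to_mpoly_is_zmod_morphism : zmod_morphism poly_to_mpoly.
Proof. by move=> f g; rewrite /poly_to_mpoly rmorphB !hornerE. Qed.

Lemma poly_to_mpoly_is_monoid_morphism : monoid_morphism poly_to_mpoly.
Proof.
by split=> [|f g]; rewrite /poly_to_mpoly ?rmorph1 ?rmorphM !hornerE.
Qed.

HB.instance Definition _ := GRing.isZmodMorphism.Build _ _ poly_to_mpoly
  poly_to_mpoly_is_zmod_morphism.
HB.instance Definition _ := GRing.isMonoidMorphism.Build _ _ poly_to_mpoly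
  poly_to_mpoly_is_monoid_morphism.

Lemma poly_to_mpoly_surj q : exists f, poly_to_mpoly f = q.
Proof.
have /choice[h hE] (i : 'I_n.+1) : exists f, poly_to_mpoly f = 'X_i.
  have [j ->|->] := unliftP ord_max i.
    exists ('X_j)%:P; rewrite /poly_to_mpoly map_polyC hornerC /= mwidenX mnmwiden1.
    by congr 'X_[U_(_)]; apply/val_inj; rewrite /= /bump leqNgt ltn_ord.
  by exists 'X; rewrite /poly_to_mpoly map_polyX hornerX.
exists (\sum_(m <- msupp q) (q@_m)%:MP%:P * \prod_i h i ^+ m i).
rewrite [RHS]mpolyE rmorph_sum; apply: eq_bigr => m _.
rewrite -mul_mpolyC mpolyXE_id rmorphM rmorph_prod /=; congr (_ * _).
  by rewrite /poly_to_mpoly map_polyC hornerC /= mwidenC.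
by apply: eq_bigr => i _; rewrite rmorphXn /= hE.
Qed.

(** The valuation on the left is the point [v] with [x] appended as last coordinate. *)
Lemma meval_poly_to_mpoly (v : 'I_n -> R) x f :
  (poly_to_mpoly f).@[fun i => oapp v x (unlift ord_max i)] =
  (map_poly (meval v) f).[x].
Proof.
set w := (fun _ => _); have wx : meval w 'X_ord_max = x by rewrite mevalXU /w unlift_none.
rewrite /poly_to_mpoly -horner_map -map_poly_comp /= wx; congr _.[x].
apply: eq_map_poly => q /=.
apply: (mpoly_rmorph_ext (f := (meval w \o @mwiden n R)) (g := meval v)) => [c|i] /=.
  by rewrite mwidenC !mevalC.
rewrite mwidenX mnmwiden1 !mevalXU /w.
have -> : widen_ord (leqnSn n) i = lift ord_max i.
  by apply/val_inj; rewrite /= /bump leqNgt ltn_ord.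
by rewrite liftK.
Qed.

End LastVariable.

Lemma mpoly0E (R : nzRingType) (q : {mpoly R[0]}) : q = (q@_0)%:MP.
Proof.
apply/mpolyP => m; rewrite mcoeffC.
by have -> : m = 0%MM; [apply/mnmP => - [] | rewrite eqxx mulr1].
Qed.

(** Avoiding the zeros of a given [s] outside [I] is what makes the induction work: the point found
    in fewer variables must avoid the zeros of [d] in order to lift. *)
Lemma mpoly_prime_ideal_point (k : closedFieldType) n (I : set {mpoly k[n]}) s :
  prime_ideal I -> ~ I s ->
  exists v : 'I_n -> k, (forall q, I q -> q.@[v] = 0) /\ s.@[v] != 0.
Proof.
elim: n => [|n IHn] in I s * => prI Is; have [idI I1 primeM] := prI.
  have I0 q : I q -> q = 0.
    move=> Iq; apply: contrapT => q0; apply: I1.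
    have c0 : q@_0 != 0 by apply: contra_notN q0 => /eqP c0; rewrite (mpoly0E q) c0.
    have -> : 1 = (q@_0)^-1%:MP * q by rewrite [X in _ * X]mpoly0E -mpolyCM mulVf.
    exact: (idealMr idI).
  exists (fun=> 0); split=> [q /I0->|]; first by rewrite meval0.
  rewrite (mpoly0E s) mevalC; apply: contra_notN Is => /eqP s0.
  by rewrite (mpoly0E s) s0; apply: (ideal0 idI).
pose J := (@poly_to_mpoly k n @^-1` I)%classic.
have prJ : prime_ideal J by apply: prime_ideal_preim.
have [s' s'E] := poly_to_mpoly_surj s.
have Js' : ~ J s' by rewrite /J /= s'E.
have [d Jd dP] := point_extension k prJ Js'.
pose K := (@polyC {mpoly k[n]} @^-1` J)%classic.
have prK : prime_ideal K by apply: prime_ideal_preim.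
have [v [Kv dv]] := IHn _ _ prK Jd.
have [x [Jx sx]] := dP (meval v) Kv dv.
exists (fun i => oapp v x (unlift ord_max i)); split=> [q Iq|].
  have [f fE] := poly_to_mpoly_surj q.
  by rewrite -fE meval_poly_to_mpoly; apply: Jx; rewrite /J /= fE.
by rewrite -s'E meval_poly_to_mpoly.
Qed.

(** * The Nullstellensatz for coordinate rings *)

Section Restriction.
Variables (k : fieldType) (X : affine_variety k).

Lemma meval_regular (q : {mpoly k[av_dim X]}) :
  (fun x : X => q.@[val x ord0]) \in @regular_pred k X.
Proof. by apply/regularP; exists q. Qed.

Definition coord_of_mpoly q : coord_ring X := CoordRing (meval_regular q).

Lemma coord_of_mpoly_is_zmod_morphism : zmod_morphism coord_of_mpoly.
Proof. by move=> a b; apply/val_inj/funext => x; rewrite /= mevalB. Qed.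

Lemma coord_of_mpoly_is_monoid_morphism : monoid_morphism coord_of_mpoly.
Proof.
split=> [|a b]; apply/val_inj/funext => x; first by rewrite /= meval1.
by rewrite /= mevalM.
Qed.

HB.instance Definition _ := GRing.isZmodMorphism.Build _ _ coord_of_mpoly
  coord_of_mpoly_is_zmod_morphism.
HB.instance Definition _ := GRing.isMonoidMorphism.Build _ _ coord_of_mpoly
  coord_of_mpoly_is_monoid_morphism.

Lemma coord_of_mpoly_surj f : exists q, coord_of_mpoly q = f.
Proof.
have [q fE] := regularP _ (coord_fun_regular f); exists q.
by apply/val_inj/funext => x /=; rewrite fE.
Qed.

End Restriction.

(** The preimage of [I] in the polynomial ring is proper and contains the equations of [X], so a
    zero of a prime ideal above it is a point of [X]. *)
Lemma coord_ring_point (k : closedFieldType) (X : affine_variety k)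
    (I : set (coord_ring X)) :
  ideal I -> ~ I 1 -> exists x : X, forall f, I f -> f x = 0.
Proof.
move=> idI I1; pose J := (@coord_of_mpoly k X @^-1` I)%classic.
have idJ : ideal J by apply: ideal_preim.
have J1 : ~ J 1 by rewrite /J /= rmorph1.
have [M prM JM] := prime_ideal_above idJ J1.
have [_ M1 _] := prM; have [v [Mv _]] := mpoly_prime_ideal_point prM M1.
have {}Mv q : J q -> q.@[(\row_i v i) ord0] = 0.
  by move=> /JM/Mv <-; apply: meval_eq => i; rewrite mxE.
have Xv : (\row_i v i : 'rV[k]_(av_dim X)) \in av_set X.
  have [S XE] := av_closed X; rewrite XE inE => q Sq; apply: Mv.
  rewrite /J /=; suff -> : coord_of_mpoly q = 0 by apply: (ideal0 idI).
  apply/val_inj/funext => x /=.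
  suff : zero_locus S (val x) by apply.
  by rewrite -XE; apply/set_mem/valP.
exists (exist (fun x : 'rV_(av_dim X) => x \in av_set X) _ Xv) => f.
by have [q <-] := coord_of_mpoly_surj f; apply: Mv.
Qed.

(** * Galois systems and their construction *)

Section RingActionTheory.
Variables (gT : finGroupType) (A : comPzRingType) (to : ring_action gT A).

(** Naming the action of a fixed [g] gives a head symbol to which the ring morphism structure
    attaches. *)
Definition ract_at (g : gT) : A -> A := to^~ g.

Lemma ract_at_is_zmod_morphism g : zmod_morphism (ract_at g).
Proof.
move=> a b; apply: (addIr (ract_at g b)).
by rewrite /ract_at -ract_additive !subrK.
Qed.

HB.instance Definition _ g := GRing.isZmodMorphism.Build A A (ract_at g)
  (ract_at_is_zmod_morphism g).
HB.instance Definition _ g := GRing.isMonoidMorphism.Build A A (ract_at g)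
  (ract_multiplicative to g).

Lemma ract_atE g a : to a g = ract_at g a. Proof. by []. Qed.

Lemma ract_at1 a : ract_at 1%g a = a. Proof. exact: total_act1. Qed.

Lemma ract_atM g h a : ract_at (g * h)%g a = ract_at h (ract_at g a).
Proof. exact: total_actM. Qed.

Lemma ring_trace_invariant a : ring_invariants to (ring_trace to a).
Proof.
move=> g; rewrite ract_atE rmorph_sum [RHS](reindex_inj (mulIg g)) /=.
by apply: eq_bigr => h _; rewrite !ract_atE ract_atM.
Qed.

(** Arbitrary finite index types allow families to be concatenated over [J + K] and multiplied over
    [J * K]. *)
Definition pairing (J : finType) (x y : J -> A) (g : gT) : A :=
  \sum_j x j * to (y j) g.

Lemma galois_extension_fin (P : {group gT}) (J : finType) (x y : J -> A) :
  (forall g, g \in P -> pairing x y g = if g == 1%g then 1 else 0) ->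
  galois_extension to P.
Proof.
move=> xyP; exists #|J|, (x \o enum_val), (y \o enum_val) => g /xyP <-.
by rewrite /pairing (reindex (@enum_val J predT)) //; apply/onW_bij/enum_val_bij.
Qed.

(** The values at 1 of families whose pairing vanishes at [g]. It contains 1 when a single family
    separates [g] from 1, a condition that the Nullstellensatz can test. *)
Definition separation_ideal (g : gT) : set A := [set c |
  exists (J : finType) (x y : J -> A), pairing x y 1%g = c /\ pairing x y g = 0]%classic.

Lemma ideal_separation g : ideal (separation_ideal g).
Proof.
split=> [|a b [J [x [y [xy1 xyg]]]] [K [u [v [uv1 uvg]]]]|a b [J [x [y [xy1 xyg]]]]].
- by exists 'I_0, (fun=> 0), (fun=> 0); split; rewrite /pairing big_ord0.
- exists (J + K)%type, (fun i => match i with inl j => x j | inr j => u j end),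
    (fun i => match i with inl j => y j | inr j => v j end).
  by split; rewrite /pairing big_sumType /= -/(pairing x y _) -/(pairing u v _)
    ?xy1 ?uv1 ?xyg ?uvg ?addr0.
- exists J, (fun j => a * x j), y.
  have E h : pairing (fun j => a * x j) y h = a * pairing x y h.
    by rewrite /pairing big_distrr /=; apply: eq_bigr => j _; rewrite mulrA.
  by rewrite !E xy1 xyg mulr0.
Qed.

Lemma sub_act_separation g a : separation_ideal g (a - to a g).
Proof.
(* The pairing of this two-term family at [h] is [to a h - to a g]. *)
exists bool, (fun b => if b then 1 else - to a g), (fun b => if b then a else 1).
by split; rewrite /pairing big_bool /= !ract_atE ?ract_at1 ?rmorph1 mul1r mulr1 // subrr.
Qed.

Lemma galois_of_separation (P : {group gT}) :
  (forall g, g \in P -> g != 1%g -> separation_ideal g 1) -> galois_extension to P.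
Proof.
move=> sepP.
suff [J [x [y [xy1 xy0]]]] : exists (J : finType) (x y : J -> A),
    pairing x y 1%g = 1 /\ forall g, g \in enum P^#%g -> pairing x y g = 0.
  apply: (@galois_extension_fin P J x y) => g Pg; have [-> //|g1] := eqVneq.
  by apply: xy0; rewrite mem_enum !inE g1.
have : {in enum P^#%g, forall g, separation_ideal g 1}.
  by move=> g; rewrite mem_enum !inE => /andP[g1 Pg]; apply: sepP.
elim: (enum _) => [_|g s IHs sep].
  exists unit, (fun=> 1), (fun=> 1); split=> //.
  by rewrite /pairing big_const card_unit /= ract_atE rmorph1 mulr1 addr0.
have [|J [x [y [xy1 xy0]]]] := IHs; first by move=> h hs; apply: sep; rewrite inE hs orbT.
have [K [u [v [uv1 uvg]]]] := sep g (mem_head g s).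
exists (J * K)%type, (fun i => x i.1 * u i.2), (fun i => y i.1 * v i.2).
have E h : pairing (fun i => x i.1 * u i.2) (fun i => y i.1 * v i.2) h =
    pairing x y h * pairing u v h.
  rewrite /pairing big_distrlr pair_big; apply: eq_bigr => i _.
  by rewrite !ract_atE rmorphM mulrACA.
split=> [|h]; rewrite E; first by rewrite xy1 uv1 mulr1.
by rewrite inE => /predU1P[->|/xy0->]; rewrite ?uvg ?mulr0 ?mul0r.
Qed.

(** Translating the family by [h] turns its pairing at [g] into the image under [h] of the old
    pairing at the conjugate of [g] in [P]. *)
Lemma galois_conj (P : {group gT}) h :
  galois_extension to P -> galois_extension to (P :^ h)%G.
Proof.
move=> [n [x [y xyP]]]; exists n, (ract_at h \o x), (ract_at h \o y) => g.
rewrite mem_conjg => /xyP; rewrite -(inj_eq (@conjg_inj _ h)) conjgKV conj1g => E.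
have -> : (if g == 1%g then 1 else 0) = ract_at h (if g == 1%g then 1 else 0).
  by case: ifP => _; rewrite ?rmorph1 ?rmorph0.
rewrite -E rmorph_sum; apply: eq_bigr => i _ /=.
by rewrite rmorphM /= !ract_atE -!ract_atM conjgE invgK !mulgA mulgKV.
Qed.

(** * Traces in a Galois extension *)

Section GaloisTrace.
Variable P : {group gT}.

Let trP a := \sum_(g in P) ract_at g a.

Let fixed a := forall g, g \in P -> ract_at g a = a.

Let fixed_trP a : fixed (trP a).
Proof.
move=> g Pg; rewrite rmorph_sum /= [RHS](reindex_inj (mulIg g)) /=.
by apply: eq_big => h; [rewrite groupMr | rewrite ract_atM].
Qed.

(* Congruence in A^P modulo the ideal tr_P(A). *)
Let cong a b := [/\ fixed a, fixed b & exists c, a - b = trP c].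

Let cong_refl a : fixed a -> cong a a.
Proof.
move=> fa; split=> //; exists 0; rewrite subrr /trP big1 // => g _.
by rewrite rmorph0.
Qed.

Let congD a b a' b' : cong a a' -> cong b b' -> cong (a + b) (a' + b').
Proof.
move=> [fa fa' [c ac]] [fb fb' [d bd]]; split=> [g Pg|g Pg|].
- by rewrite rmorphD /= fa // fb.
- by rewrite rmorphD /= fa' // fb'.
exists (c + d); rewrite opprD addrACA ac bd /trP -big_split.
by apply: eq_bigr => g _; rewrite rmorphD.
Qed.

Let congM a b a' b' : cong a a' -> cong b b' -> cong (a * b) (a' * b').
Proof.
move=> [fa fa' [c ac]] [fb fb' [d bd]]; split=> [g Pg|g Pg|].
- by rewrite rmorphM /= fa // fb.
- by rewrite rmorphM /= fa' // fb'.
exists (c * b + a' * d).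
have -> : a * b - a' * b' = (a - a') * b + a' * (b - b').
  by rewrite mulrBl mulrBr addrA subrK.
rewrite ac bd /trP big_distrl big_distrr -big_split.
by apply: eq_bigr => g Pg; rewrite rmorphD !rmorphM /= fb // fa'.
Qed.

Lemma galois_trace1 :
  galois_extension to P -> exists a, \sum_(g in P) ract_at g a = 1.
Proof.
move=> [n [x [y xyP]]].
(* The Galois relations express each [x j] through the [x i] with trace coefficients, so [v] is
   fixed by [M]. *)
pose M : 'M[A]_n := \matrix_(i, j) trP (y i * x j).
pose v : 'rV[A]_n := \row_i x i.
have vM : v *m M = v.
  apply/rowP => j; rewrite !mxE.
  transitivity (\sum_(g in P) (if g == 1%g then 1 else 0) * ract_at g (x j)).
    under eq_bigr => i _ do rewrite !mxE /trP big_distrr /=.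
    rewrite exchange_big; apply: eq_bigr => g Pg.
    rewrite -(xyP g Pg) big_distrl; apply: eq_bigr => i _.
    by rewrite rmorphM /= mulrA.
  rewrite (bigD1 1%g) //= eqxx mul1r ract_at1 big1 ?addr0 // => g /andP[_ /negPf->].
  by rewrite mul0r.
(* By the adjugate identity the determinant kills every [x i], hence also 1, which is the sum of the
   [x i * y i]. *)
have det0 : \det (1%:M - M) = 0.
  have : v *m (1%:M - M) *m \adj (1%:M - M) = 0.
    by rewrite mulmxBr mulmx1 vM subrr mul0mx.
  rewrite -mulmxA mul_mx_adj mul_mx_scalar => /rowP dv.
  have := xyP _ (group1 P); rewrite eqxx => xy1.
  rewrite -[LHS]mulr1 -[X in _ * X]xy1 big_distrr.
  by apply: big1 => i _; have := dv i; rewrite !mxE /= mulrA => ->; rewrite mul0r.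
(* One form for 0, 1, the signs of permutations and the entries of the identity matrix. *)
have fixed_sign (b : bool) m : fixed ((-1) ^+ b *+ m).
  by move=> g _; rewrite rmorphMn rmorphXn rmorphN1.
(* The entries of [M] are traces, so the Leibniz expansions agree term by term modulo traces; hence
   0 is congruent to 1. *)
have : cong (\det (1%:M - M)) (\det (1%:M : 'M[A]_n)).
  apply: (big_ind2 cong); first exact: (cong_refl (fixed_sign false 0%N)).
    by move=> a a' b b' aa' bb'; apply: (congD aa' bb').
  move=> s _; apply: (congM (cong_refl (fixed_sign s 1%N))).
  apply: (big_ind2 cong); first exact: (cong_refl (fixed_sign false 1%N)).
    by move=> a a' b b' aa' bb'; apply: (congM aa' bb').
  move=> i _; rewrite !mxE.
  have f1 : fixed (i == s i)%:R by exact: (fixed_sign false (i == s i)).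
  split=> //.
    by move=> g Pg; rewrite rmorphB /= f1 // fixed_trP.
  exists (- (y i * x (s i))); rewrite addrAC subrr sub0r /trP -sumrN.
  by apply: eq_bigr => g _; rewrite rmorphN.
rewrite det0 det1 => -[_ _ [c]]; rewrite sub0r => c1; exists (- c).
by rewrite -[RHS]opprK c1 /trP -sumrN; apply: eq_bigr => g _; rewrite rmorphN.
Qed.

(** The full trace splits over the right cosets of [P]; the coset of [r] contributes the image under
    [r] of the [P]-trace, which is 1. *)
Lemma galois_ring_trace :
  galois_extension to P -> exists a, ring_trace to a = #|[set: gT] : P|%g%:R.
Proof.
move=> /galois_trace1[a a1]; exists a.
have partG := rcosets_partition (finset.subsetT P).
transitivity (\sum_(g in [set: gT]) ract_at g a).
  by apply: eq_bigl => g; rewrite finset.in_setT.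
rewrite (set_partition_big _ partG) /= -sumr_const; apply: eq_bigr => C.
case/rcosetsP => r _ ->; rewrite (reindex_inj (mulIg r)) /=.
rewrite -(rmorph1 (ract_at r)) -a1 rmorph_sum; apply: eq_big => g.
  by rewrite mem_rcoset mulgK.
by rewrite ract_atM.
Qed.

End GaloisTrace.
End RingActionTheory.

(** * Stabilizers and the trace on a coordinate ring *)

Section VarietyAction.
Variables (k : fieldType) (gT : finGroupType) (X : affine_variety k).
Variable to : variety_action gT X.

Lemma group_set_point_stabilizer x : group_set (point_stabilizer to x).
Proof.
apply/group_setP; split=> [|g h]; rewrite !inE ?total_act1 //.
by move=> /eqP xg /eqP xh; rewrite total_actM xg xh.
Qed.

Canonical point_stabilizer_group x := Group (group_set_point_stabilizer x).

Lemma coord_ring_sumE (J : Type) (r : seq J) (P : pred J) (F : J -> coord_ring X) x :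
  (\sum_(j <- r | P j) F j) x = \sum_(j <- r | P j) F j x.
Proof. exact: (big_morph (fun f : coord_ring X => f x)). Qed.

Lemma coord_ring_finitely_generated : finitely_generated (@coord_const k X).
Proof.
exists (av_dim X), (fun i => coord_of_mpoly (X := X) 'X_i) => f.
have [q <-] := coord_of_mpoly_surj f; exists q.
have coord_of_mpolyC c : coord_const X c = coord_of_mpoly (X := X) c%:MP.
  by apply/val_inj/funext => x; rewrite /= mevalC.
rewrite [in LHS](mpolyE q) rmorph_sum; apply: eq_bigr => m _.
rewrite -mul_mpolyC mpolyXE_id rmorphM rmorph_prod /= coord_of_mpolyC.
by congr (_ * _); apply: eq_bigr => i _; rewrite rmorphXn.
Qed.

Lemma coord_ring_separates (x y : X) : (forall f : coord_ring X, f x = f y) -> x = y.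
Proof.
move=> fxy; apply/val_inj/rowP => i.
by have := fxy (coord_of_mpoly (X := X) 'X_i); rewrite /= !mevalXU.
Qed.

Lemma coprime_point_stabilizer p (pcharkp : p \in [pchar k]) x :
  in_Ts (coord_alg_action to) -> coprime #|point_stabilizer to x| p.
Proof.
case=> _ trE; rewrite coprime_sym prime_coprime ?(pcharf_prime pcharkp) //.
apply/negP => p_dvd.
(* The constant 1 is invariant, hence a trace. *)
have [f _ trf] : range (ring_trace (coord_alg_action to)) 1.
  by rewrite trE => g; rewrite ract_atE rmorph1.
have := congr1 (fun h : coord_ring X => h x) trf.
pose H := point_stabilizer_group x.
rewrite /ring_trace coord_ring_sumE => /eqP; apply/negP; rewrite eq_sym.
suff -> : \sum_g f (to x g^-1%g) = 0 by rewrite oner_eq0.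
(* After inversion the summand is [f (to x g)], which is constant on right cosets of the
   stabilizer. *)
rewrite (reindex_inj invg_inj) /=.
transitivity (\sum_(g in [set: gT]) f (to x g)).
  by apply: eq_big => g; rewrite ?finset.in_setT ?invgK.
rewrite (set_partition_big _ (rcosets_partition (finset.subsetT H))) big1 // => C.
case/rcosetsP => g _ ->; rewrite (reindex_inj (mulIg g)) /=.
transitivity (\sum_(h in H) f (to x g)).
  apply: eq_big => h; rewrite mem_rcoset mulgK // inE total_actM.
  by move=> /eqP->.
rewrite sumr_const -mulr_natr; apply/eqP.
by rewrite mulf_eq0 -(dvdn_pcharf pcharkp) p_dvd orbT.
Qed.

End VarietyAction.

(** * From free Sylow actions to Galois extensions and back to the trace *)

Lemma coprime_stabilizers_galois (k : closedFieldType) (p : nat)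
    (gT : finGroupType) (X : affine_variety k) (to : variety_action gT X)
    (P : {group gT}) :
  prime p -> (p.-group P)%g -> (forall x, coprime #|point_stabilizer to x| p) ->
  galois_extension (coord_alg_action to) P.
Proof.
move=> p_pr pP coX; apply: galois_of_separation => g Pg g1; apply: contrapT => sep1.
(* At a common zero of the separation ideal every [f] takes the same value at [x] and at
   [to x g^-1], so [g] fixes [x] and its order, a nontrivial power of [p], divides that of the
   stabilizer. *)
have [x xP] := coord_ring_point (ideal_separation _ g) sep1.
have xg : to x g^-1%g = x.
  apply: coord_ring_separates => f; apply/eqP; rewrite eq_sym -subr_eq0; apply/eqP.
  exact: (xP _ (sub_act_separation (coord_alg_action to) g f)).
have /order_dvdG : g^-1%g \in point_stabilizer_group to x by rewrite inE xg.
rewrite orderV => dvd_gx.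
have := coX x; rewrite coprime_sym prime_coprime // => /negP; apply; apply: dvdn_trans dvd_gx.
have [n on] := p_natP (mem_p_elt pP Pg).
by case: n on => [/eqP|n ->]; rewrite ?order_eq1 ?(negPf g1) // expnS dvdn_mulr.
Qed.

Lemma galois_sylow_in_Ts (k : fieldType) (p : nat) (pcharkp : p \in [pchar k])
    (gT : finGroupType) (X : affine_variety k) (to : variety_action gT X)
    (P : {group gT}) :
  (p.-Sylow([set: gT]) P)%g -> galois_extension (coord_alg_action to) P ->
  in_Ts (coord_alg_action to).
Proof.
move=> sylP /galois_ring_trace[a tra]; split.
  exact: coord_ring_finitely_generated.
apply/seteqP; split=> [_ [f _ <-]|b bG]; first exact: ring_trace_invariant.
have idx0 : #|[set: gT] : P|%g%:R != 0 :> k.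
  rewrite -(dvdn_pcharf pcharkp) -p'natE ?(pcharf_prime pcharkp) //.
  by have /and3P[] := sylP.
set m := #|_ : _|%g in tra idx0; pose c := coord_const X m%:R^-1.
(* The invariant factor [b * c] comes out of the trace, and [c] cancels the index. *)
exists (a * (b * c)) => //.
transitivity (ring_trace (coord_alg_action to) a * (b * c)).
  rewrite /ring_trace big_distrl; apply: eq_bigr => g _.
  rewrite !ract_atE !rmorphM; congr (_ * (_ * _)); first exact: bG.
  exact: (alg_ract_scalar (coord_alg_action to)).
rewrite tra mulrCA -(rmorph_nat (@coord_const k X)) -rmorphM divff //.
by rewrite rmorph1 mulr1.
Qed.

Theorem theorem0p8 (k : closedFieldType) (p : nat) (pcharkp : p \in [pchar k]%R)
    (X : affine_variety k) (gT : finGroupType) (to : variety_action gT X) :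
  [<-> in_Ts (coord_alg_action to);
       forall x : X, coprime #|point_stabilizer to x| p;
       exists P : {group gT}, P \in ('Syl_p([set: gT]))%g /\
         galois_extension (coord_alg_action to) P;
       forall P : {group gT}, P \in ('Syl_p([set: gT]))%g ->
         galois_extension (coord_alg_action to) P].
Proof.
have p_pr := pcharf_prime pcharkp.
have [P0 sylP0] := Sylow_exists p [set: gT].
tfae.
- by move=> Ts x; apply: coprime_point_stabilizer.
- move=> coX; exists P0; rewrite inE; split=> //.
  exact: coprime_stabilizers_galois (pHall_pgroup sylP0) coX.
- move=> [P [sylP galP]] Q; rewrite !inE in sylP * => sylQ.
  have [g _ QE] := Sylow_trans sylP sylQ.
  have -> : Q = (P :^ g)%G by apply/val_inj.
  exact: galois_conj.
- by move=> gal; apply: (galois_sylow_in_Ts pcharkp sylP0); apply: gal; rewrite inE.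
Qed.
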